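(* Let $M, N$ be positive integers and let $r$ be an integer with $0 \le r \le \min(M,N)$. Let $f_{(M \times N; r)}(q)$ be the generating function for partitions in the $M \times N$ box with exactly $r$ different part sizes. Then $$f_{(M \times N; r)}(q) = \sum_{r_0 = r}^{\min(M,N)} \binom{r_0}{r} (-1)^{r_0-r} q^{\binom{r_0+1}{2}} \left[ {M \atop {r_0}} \right]_q \left[ {{M+N-r_0} \atop {N-r_0}} \right]_q.$$
   Context: A partition lies in the $M \times N$ box if it has at most $N$ parts, each of size at most $M$. The generating function $f_{(M\times N;r)}(q)$ is $\sum_{\lambda} q^{|\lambda|}$, the sum being over all partitions $\lambda$ in the $M\times N$ box having exactly $r$ distinct part sizes, where $|\lambda|$ is the sum of the parts of $\lambda$; the empty partition has $r=0$. The $q$-binomial coefficient is $\left[ {A+B \atop B} \right]_q = \frac{(q)_{A+B}}{(q)_A (q)_B}$ for integers $A, B \ge 0$, where $(q)_m = (1-q)(1-q^2)\cdots(1-q^m)$. *)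

(* Defs.v *)
From mathcomp Require Import all_boot all_order all_algebra.
Set Implicit Arguments.
Unset Strict Implicit.
Unset Printing Implicit Defensive.

Import GRing.Theory.
Local Open Scope ring_scope.

(* A partition is the weakly decreasing list of its positive parts. *)
Definition is_partition (s : seq nat) : bool :=
  sorted geq s && all (fun i => 0 < i)%N s.

(* A list of at most N elements of 'I_M.+1, read as a list of parts: this is
   where the bounds of the M x N box are imposed. *)
Definition parts (M N : nat) (s : {bseq N of 'I_M.+1}) : seq nat :=
  [seq val i | i <- s].

Definition box_partition_gf (M N r : nat) : {poly int} :=
  \sum_(s : {bseq N of 'I_M.+1} |
          is_partition (parts s) && (size (undup (parts s)) == r))
     'X^(sumn (parts s)).

Definition qpoch (m : nat) : {poly int} := \prod_(1 <= i < m.+1) (1 - 'X^i).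

(* [n, k]_q as an element of the field of rational functions; only meaningful
   for k <= n, since n - k is truncated. *)
Definition qbinom (n k : nat) : {fraction {poly int}} :=
  tofrac (qpoch n) / (tofrac (qpoch (n - k)) * tofrac (qpoch k)).

(* Main.v *)
(** Deleting one copy of the part M+1 from a partition in the
    (M+1) x (N+1) box that contains it leaves a partition in the
    (M+1) x N box, and the number of distinct part sizes drops by one exactly
    when no copy of M+1 remains. Hence, for any weight w on the number of
    distinct part sizes, the weighted generating functions S_w satisfy
      S_w(M+1,N+1) = S_w(M,N+1) + q^(M+1) (S_w(M+1,N) + S_(Dw)(M,N)),
    where D is the forward difference. The product of the two q-binomials is
    the trinomial (q)_(M+N-k) / ((q)_k (q)_(M-k) (q)_(N-k)), and the matching
    recurrence for it gives the q-analogue of Newton's formula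
      S_w(M,N) = sum_k (D^k w)(0) q^(k(k+1)/2) [M+N-k; k, M-k, N-k]_q.
    The theorem is the case where w is the indicator function of r. *)
Require Import Defs.
From mathcomp Require Import all_boot all_order all_algebra.
From mathcomp Require Import zify ring.
Import GRing.Theory.
Local Open Scope ring_scope.

(** * Recursive enumeration of the partitions in a box *)

Fixpoint box_partitions (M : nat) : nat -> seq (seq nat) :=
  if M is M'.+1 then
    fix boxM (N : nat) : seq (seq nat) :=
      if N is N'.+1 then
        box_partitions M' N ++ [seq M :: s | s <- boxM N']
      else [:: [::]]
  else fun=> [:: [::]].

Lemma box_partitions_n0 M : box_partitions M 0 = [:: [::]].
Proof. by case: M. Qed.

(** The split by whether the part [M.+1] occurs: if not, the width bound drops; if so, removing its
    leading copy lowers the bound on the number of parts. Hence the two nested fixpoints. *)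
Lemma box_partitionsSS M N :
  box_partitions M.+1 N.+1 =
  box_partitions M N.+1 ++ [seq M.+1 :: s | s <- box_partitions M.+1 N].
Proof. by []. Qed.

Lemma is_partition_cons x s :
  is_partition (x :: s) = [&& 0 < x, all (geq x) s & is_partition s]%N.
Proof.
rewrite /is_partition /= path_sortedE; last by move=> a b c /= H1 H2; lia.
by case: (0 < x)%N; rewrite /= ?andbF // -andbA.
Qed.

Lemma mem_box_partitions M N s :
  (s \in box_partitions M N) =
  [&& is_partition s, all (geq M) s & size s <= N]%N.
Proof.
elim: M N s => [|M IHM] N s.
  case: s => [|x s] //; rewrite is_partition_cons /= leqn0.
  by case: x => [|x]; rewrite ?andbF.
elim: N s => [|N IHN] s.
  by case: s => [|x s] //; rewrite /= inE andbC ltn0 !andbF.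
rewrite box_partitionsSS mem_cat IHM.
case: s => [|x s]; first by [].
have -> : (x :: s \in [seq M.+1 :: t | t <- box_partitions M.+1 N]) =
          (x == M.+1) && (s \in box_partitions M.+1 N).
  apply/mapP/andP => [[t Ht [-> ->]] | [/eqP-> Hs]]; first by rewrite eqxx.
  by exists s.
rewrite IHN !is_partition_cons /= ltnS.
have [-> | neqx] := eqVneq x M.+1.
  rewrite ltnn !andbF leqnn /=.
  by case: (all _ s) => /=; rewrite ?andbF.
rewrite orbF [(x <= M.+1)%N]leq_eqVlt (negbTE neqx) /= ltnS.
case: (leqP x M) => xM /=; rewrite ?andbF //.
case Hs: (all (geq x) s); rewrite /= ?andbF //.
have -> : all (geq M) s by apply: sub_all Hs => y /= yx; lia.
by have -> : all (geq M.+1) s by apply: sub_all Hs => y /= yx; lia.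
Qed.

Lemma box_partitions_uniq M N : uniq (box_partitions M N).
Proof.
elim: M N => [|M IHM] // N; elim: N => [|N IHN] //.
rewrite box_partitionsSS cat_uniq IHM map_inj_uniq ?IHN; last by move=> ? ? [].
rewrite andbT; apply/hasPn => _ /mapP[t _ ->].
by rewrite mem_box_partitions /= ltnn !andbF.
Qed.

Lemma parts_inj M N : injective (@parts M N).
Proof. by move=> s t /(inj_map val_inj) /val_inj. Qed.

(** Transfers sums from the finite type of the specification to the recursive list: [parts] is
    injective and both sides run over the same partitions, each once. *)
Lemma big_box_partitions (R : nmodType) M N (F : seq nat -> R) :
  \sum_(s : {bseq N of 'I_M.+1} | is_partition (parts s)) F (parts s) =
  \sum_(s <- box_partitions M N) F s.
Proof.
rewrite -big_filter -(big_map (@parts M N) predT F).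
apply/perm_big/uniq_perm.
- rewrite map_inj_uniq; last exact: parts_inj.
  by rewrite filter_uniq // index_enum_uniq.
- exact: box_partitions_uniq.
move=> s; rewrite mem_box_partitions; apply/mapP/and3P.
  case=> t; rewrite mem_filter => /andP[Ht _] ->; split=> //.
    by apply/allP => _ /mapP[i _ ->]; rewrite /= -ltnS.
  by rewrite size_map size_bseq.
move=> [Hs /allP sM sN].
(* The preimage of [s] under [parts]; the default value of [inord] is never reached, since all parts
   are at most [M]. *)
have szs : (size [seq (inord i : 'I_M.+1) | i <- s] <= N)%N by rewrite size_map.
have E : parts (Bseq szs) = s.
  rewrite /parts /= -map_comp -[RHS]map_id; apply/eq_in_map => i /sM /= iM.
  by rewrite inordK.
by exists (Bseq szs); rewrite // mem_filter E Hs mem_index_enum.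
Qed.

(** * Forward differences of weights *)

Definition fdiff (R : zmodType) (w : nat -> R) (j : nat) : R := w j.+1 - w j.

(** Pascal's rule, by induction on [k] with [j] free; only [j = 0] is used later. The sign exponent
    is a sum, of the same parity as [k - (r - j)], to avoid truncated subtraction. *)
Lemma iter_fdiff_indicator (R : pzRingType) (r k j : nat) :
  iter k (@fdiff R) (fun i => (i == r)%:R) j =
  if (j <= r)%N then (-1) ^+ (k + (r - j)) * 'C(k, r - j)%:R else 0.
Proof.
elim: k j => [|k IHk] j /=.
  rewrite add0n bin0n subn_eq0 eqn_leq.
  case: (leqP j r) => jr //=; case: (leqP r j) => rj /=; last by rewrite mulr0.
  have -> : (r - j = 0)%N by lia.
  by rewrite expr0 mulr1.
rewrite /fdiff !IHk; case: (ltngtP j r) => jr.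
- have -> : (r - j = (r - j.+1).+1)%N by lia.
  rewrite binS natrD !addnS addSn !exprS !mulN1r opprK mulrDr addrC.
  by rewrite mulNr opprK.
- by rewrite subr0.
- by rewrite jr subnn !bin0 !addn0 exprS !mulr1 mulN1r sub0r.
Qed.

(** * Weighted generating functions and their recurrence *)

Definition weighted_gf (R : pzRingType) (q : R) (w : nat -> R) (M N : nat) : R :=
  \sum_(s <- box_partitions M N) w (size (undup s)) * q ^+ sumn s.

Lemma weighted_gf_recl (R : comPzRingType) (q : R) (w : nat -> R) M N :
  weighted_gf R q w M.+1 N.+1 = weighted_gf R q w M N.+1 +
    q ^+ M.+1 * (weighted_gf R q w M.+1 N + weighted_gf R q (fdiff R w) M N).
Proof.
rewrite {1}/weighted_gf box_partitionsSS big_cat big_map; congr (_ + _).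
have notin s : s \in box_partitions M N -> (M.+1 \in s) = false.
  rewrite mem_box_partitions => /and3P[_ /allP sM _].
  by apply/negP => /sM /=; rewrite ltnn.
(* Exactly one copy of [M.+1]: it adds a new part size, and [w j.+1] is [w j + fdiff R w j]. *)
have base : \sum_(s <- box_partitions M N)
      w (size (undup (M.+1 :: s))) * q ^+ sumn (M.+1 :: s) =
    q ^+ M.+1 * (weighted_gf R q w M N + weighted_gf R q (fdiff R w) M N).
  rewrite /weighted_gf -big_split big_distrr /=.
  apply: eq_big_seq => s /notin -> /=.
  by rewrite exprD /fdiff; ring.
case: N notin base => [|N] notin base.
  by move: base; rewrite /weighted_gf !box_partitions_n0.
rewrite box_partitionsSS big_cat base /=.
rewrite [weighted_gf R q w M.+1 N.+1]/weighted_gf box_partitionsSS big_cat /=.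
rewrite -/(weighted_gf R q w M N.+1) addrAC mulrDr [in RHS]mulrDr.
rewrite !mulrDr; congr (_ + _).
(* What remains has at least two copies of [M.+1], so deleting one keeps the set of part sizes. *)
rewrite big_distrr /= !big_map; apply: eq_bigr => s _ /=.
by rewrite mem_head exprD; ring.
Qed.

(** * The q-trinomial coefficients and their recurrence *)

Section QTrinomial.
Variables (F : fieldType) (q : F).
Hypothesis q_not_root1 : forall m, 1 - q ^+ m.+1 != 0.

Definition qpochhammer (m : nat) : F := \prod_(1 <= i < m.+1) (1 - q ^+ i).

Lemma qpochhammer0 : qpochhammer 0 = 1.
Proof. by rewrite /qpochhammer big_geq. Qed.

Lemma qpochhammerS m : qpochhammer m.+1 = qpochhammer m * (1 - q ^+ m.+1).
Proof. by rewrite /qpochhammer big_nat_recr. Qed.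

Lemma qpochhammer_neq0 m : qpochhammer m != 0.
Proof.
elim: m => [|m IHm]; first by rewrite qpochhammer0 oner_neq0.
by rewrite qpochhammerS mulf_neq0.
Qed.

(** The power of [q] is built in, and the value 0 outside the range makes the recurrences hold at
    the boundary too. *)
Definition qtrinomial (k M N : nat) : F :=
  if (k <= M)%N && (k <= N)%N then
    q ^+ 'C(k.+1, 2) * qpochhammer (M + N - k) /
      (qpochhammer k * qpochhammer (M - k) * qpochhammer (N - k))
  else 0.

Lemma qtrinomial_shift k a b :
  qtrinomial k (k + a) (k + b) =
  q ^+ 'C(k.+1, 2) * qpochhammer (k + a + b) /
    (qpochhammer k * qpochhammer a * qpochhammer b).
Proof.
rewrite /qtrinomial !leq_addr /= !addKn.
by have -> : (k + a + (k + b) - k = k + a + b)%N by lia.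
Qed.

Lemma qtrinomialE k M N : (k <= M)%N -> (k <= N)%N ->
  qtrinomial k M N =
  q ^+ 'C(k.+1, 2) * (qpochhammer M / (qpochhammer (M - k) * qpochhammer k)) *
    (qpochhammer (M + N - k) / (qpochhammer M * qpochhammer (N - k))).
Proof.
move=> kM kN; rewrite /qtrinomial kM kN.
have hM := qpochhammer_neq0 M; have hk := qpochhammer_neq0 k.
have hMk := qpochhammer_neq0 (M - k); have hNk := qpochhammer_neq0 (N - k).
by field; apply/and4P.
Qed.

Lemma qtrinomial_small k M N : (minn M N < k)%N -> qtrinomial k M N = 0.
Proof. by move=> ltk; rewrite /qtrinomial -leq_min leqNgt ltk. Qed.

Lemma qtrinomial_0n k N : qtrinomial k 0 N = (k == 0)%:R.
Proof.
case: k => [|k]; last by rewrite qtrinomial_small // min0n.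
by rewrite -[N]add0n (qtrinomial_shift 0 0) qpochhammer0 /= expr0 !mul1r
  divff ?qpochhammer_neq0.
Qed.

Lemma qtrinomial_n0 k M : qtrinomial k M 0 = (k == 0)%:R.
Proof.
case: k => [|k]; last by rewrite qtrinomial_small // minn0.
by rewrite -[M]add0n (qtrinomial_shift 0 _ 0) qpochhammer0 /= expr0 addn0 !mul1r
  mulr1 divff ?qpochhammer_neq0.
Qed.

(** The q-Pascal rule, from [1 - xy = (1 - x) + x(1 - y)] with [x = q^(M+1)] and [y = q^(N+1)]. *)
Lemma qtrinomial0_rec M N :
  qtrinomial 0 M.+1 N.+1 =
  qtrinomial 0 M N.+1 + q ^+ M.+1 * qtrinomial 0 M.+1 N.
Proof.
have shift0 a b : qtrinomial 0 a b =
    qpochhammer (a + b) / (qpochhammer a * qpochhammer b).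
  by rewrite (qtrinomial_shift 0) qpochhammer0 !mul1r.
rewrite !shift0 addSn addnS !qpochhammerS.
have -> : q ^+ (M + N).+2 = q ^+ M.+1 * q ^+ N.+1.
  by rewrite -exprD addSn addnS.
have hM := q_not_root1 M; have hN := q_not_root1 N.
have hpM := qpochhammer_neq0 M; have hpN := qpochhammer_neq0 N.
by field; apply/and4P.
Qed.

(** With [M = k + a] and [N = k + b], clearing common factors leaves [1 - q^(k+a+b+1) = (1 - q^a) +
    q^(k+a+1) (1 - q^b) + q^a (1 - q^(k+1))]. *)
Lemma qtrinomialS_rec k M N :
  qtrinomial k.+1 M.+1 N.+1 =
  qtrinomial k.+1 M N.+1 +
    q ^+ M.+1 * (qtrinomial k.+1 M.+1 N + qtrinomial k M N).
Proof.
have [kmin | mink] := leqP k (minn M N); last first.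
  by rewrite !qtrinomial_small ?addr0 ?mulr0 ?addr0 //; lia.
move: kmin; rewrite leq_min => /andP[/subnKC <- /subnKC <-].
move: (M - k)%N (N - k)%N => a b.
(* At [a = 0] the factor [1 - q ^+ a] vanishes, in agreement with the value 0 out of range; [right_]
   is the same with [b]. *)
have left_ : qtrinomial k.+1 (k + a) (k + b).+1 =
    q ^+ 'C(k.+2, 2) * qpochhammer (k + a + b) * (1 - q ^+ a) /
      (qpochhammer k.+1 * qpochhammer a * qpochhammer b).
  case: a => [|a]; first by rewrite qtrinomial_small ?subrr ?mulr0 ?mul0r //; lia.
  rewrite -[(k + a.+1)%N]addSnnS -[(k + b).+1]addSn qtrinomial_shift (qpochhammerS a).
  have ha := q_not_root1 a; have hpa := qpochhammer_neq0 a.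
  have hk := qpochhammer_neq0 k.+1; have hb := qpochhammer_neq0 b.
  by field; apply/and4P.
have right_ : qtrinomial k.+1 (k + a).+1 (k + b) =
    q ^+ 'C(k.+2, 2) * qpochhammer (k + a + b) * (1 - q ^+ b) /
      (qpochhammer k.+1 * qpochhammer a * qpochhammer b).
  case: b {left_} => [|b]; first by rewrite qtrinomial_small ?subrr ?mulr0 ?mul0r //; lia.
  rewrite -[(k + b.+1)%N]addSnnS -[(k + a).+1]addSn qtrinomial_shift.
  rewrite addnS -!addSn (qpochhammerS b).
  have hb := q_not_root1 b; have hpb := qpochhammer_neq0 b.
  have hk := qpochhammer_neq0 k.+1; have ha := qpochhammer_neq0 a.
  by field; apply/and4P.
rewrite left_ right_ -[(k + b).+1]addSn -[(k + a).+1]addSn !qtrinomial_shift.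
have -> : q ^+ 'C(k.+2, 2) = q ^+ k.+1 * q ^+ 'C(k.+1, 2).
  by rewrite binS bin1 exprD mulrC.
move: (q ^+ 'C(k.+1, 2)) => c.
rewrite !addSn !qpochhammerS -2!addSn !exprD.
have hk := q_not_root1 k; have hpk := qpochhammer_neq0 k.
have ha := qpochhammer_neq0 a; have hb := qpochhammer_neq0 b.
by field; apply/and4P.
Qed.

(** Both sides obey the same recurrence and boundary values. The cutoff [K] is free so that boxes
    with different minima share one range of summation, and [w] is general because the recurrence
    passes to [fdiff F w]. *)
Lemma weighted_gf_newton K (w : nat -> F) M N : (minn M N < K)%N ->
  weighted_gf F q w M N =
  \sum_(k < K) iter k (@fdiff F) w 0 * qtrinomial k M N.
Proof.
have base (v : nat -> F) L :
    v 0 = \sum_(k < L.+1) iter k (@fdiff F) v 0 * (k == 0 :> nat)%:R.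
  rewrite big_ord_recl big1 => [|i _]; last by rewrite mulr0.
  by rewrite mulr1 addr0.
elim: M N K w => [|M IHM] N K w.
  case: K => // K _; under eq_bigr do rewrite qtrinomial_0n.
  by rewrite -base /weighted_gf big_seq1 mulr1.
elim: N K w => [|N IHN] [|K] w //.
  move=> _; under eq_bigr do rewrite qtrinomial_n0.
  by rewrite -base /weighted_gf big_seq1 mulr1.
move=> ltK; rewrite weighted_gf_recl.
rewrite (IHM N.+1 K.+1) ?(IHN K.+1) ?(IHM N K); try lia.
have split0 A B : \sum_(k < K.+1) iter k (@fdiff F) w 0 * qtrinomial k A B =
    w 0 * qtrinomial 0 A B +
    \sum_(k < K) iter k.+1 (@fdiff F) w 0 * qtrinomial k.+1 A B.
  exact: big_ord_recl.
have recS : \sum_(k < K) iter k.+1 (@fdiff F) w 0 * qtrinomial k.+1 M.+1 N.+1 =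
    \sum_(k < K) iter k.+1 (@fdiff F) w 0 * qtrinomial k.+1 M N.+1 +
    q ^+ M.+1 *
    (\sum_(k < K) iter k.+1 (@fdiff F) w 0 * qtrinomial k.+1 M.+1 N +
     \sum_(k < K) iter k (@fdiff F) (fdiff F w) 0 * qtrinomial k M N).
  rewrite -big_split big_distrr -big_split /=; apply: eq_bigr => k _.
  by rewrite qtrinomialS_rec -iterSr /=; ring.
by rewrite !split0 qtrinomial0_rec recS; ring.
Qed.
End QTrinomial.

(** * Specialization to the indeterminate and the indicator weight *)

Lemma qpoch_tofrac m :
  tofrac (qpoch m) = qpochhammer {fraction {poly int}} (tofrac 'X) m.
Proof.
rewrite /qpoch /qpochhammer rmorph_prod; apply: eq_bigr => i _.
by rewrite rmorphB rmorphXn rmorph1.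
Qed.

Lemma tofracX_not_root1 m :
  1 - tofrac 'X ^+ m.+1 != 0 :> {fraction {poly int}}.
Proof.
have -> : 1 - tofrac 'X ^+ m.+1 = tofrac (1 - 'X^(m.+1)) :> {fraction {poly int}}.
  by rewrite rmorphB rmorphXn rmorph1.
rewrite tofrac_eq0.
(* The polynomial takes the value 1 at 0. *)
by apply/eqP => /(congr1 (horner^~ 0)); rewrite !hornerE expr0n subr0.
Qed.

Theorem theorem4 (M N r : nat)
    (hM : (0 < M)%N) (hN : (0 < N)%N) (hr : (r <= minn M N)%N) :
  tofrac (box_partition_gf M N r) =
  \sum_(r <= r0 < (minn M N).+1)
     'C(r0, r)%:R * (-1) ^+ (r0 - r) * (tofrac 'X) ^+ 'C(r0.+1, 2)
       * qbinom M r0 * qbinom (M + N - r0) (N - r0)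
  :> {fraction {poly int}}.
Proof.
have -> : tofrac (box_partition_gf M N r) =
    weighted_gf {fraction {poly int}} (tofrac 'X) (fun i => (i == r)%:R) M N.
  rewrite /box_partition_gf big_mkcondr rmorph_sum /=.
  rewrite /weighted_gf -big_box_partitions; apply: eq_bigr => s _.
  case: eqP => _; last by rewrite mul0r rmorph0.
  by rewrite mul1r rmorphXn.
rewrite (weighted_gf_newton _ _ tofracX_not_root1 (minn M N).+1) //.
rewrite -(big_mkord predT (fun k => iter k _ _ 0 * qtrinomial _ _ k M N)).
(* The terms with [k < r] vanish with ['C(k, r)]. *)
rewrite [LHS](big_cat_nat (leq0n r) (leqW hr)) /= big_nat big1 ?add0r; last first.
  by move=> k kr; rewrite iter_fdiff_indicator subn0 bin_small // mulr0 mul0r.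
apply: eq_big_nat => k /andP[rk]; rewrite ltnS leq_min => /andP[kM kN].
rewrite iter_fdiff_indicator /= subn0 (qtrinomialE _ _ tofracX_not_root1) //.
(* [k + r] and [k - r] have the same parity. *)
rewrite -signr_odd oddD -oddB // signr_odd /qbinom !qpoch_tofrac.
have -> : (M + N - k - (N - k) = M)%N by lia.
by rewrite [_ * 'C(k, r)%:R]mulrC !mulrA.
Qed.
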